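(* Let $1<p<\infty$. The space $V_p(\lambda)$ is $k$-nearly uniformly convex ($k$-NUC) for every integer $k\ge 2$.
   Context: Let $\ell^0$ be the space of all real sequences $x=(x(i))_{i=1}^\infty$. Let $(\lambda_k)_{k\ge1}$ be a nondecreasing sequence of positive real numbers tending to infinity with $\lambda_1=1$ and $\lambda_{k+1}\le\lambda_k+1$ for all $k$. For $k\ge 1$ put $I_k=[k-\lambda_k+1,\,k]$; sums over $i\in I_k$ run over the integers in this interval. The space $V_p(\lambda)$ is $$V_p(\lambda)=\left\{x\in\ell^0:\ \sum_{k=1}^\infty\left(\frac1{\lambda_k}\sum_{i\in I_k}|x(i)|\right)^p<\infty\right\},$$ equipped with the norm $\|x\|=\left(\sum_{k=1}^\infty\left(\frac1{\lambda_k}\sum_{i\in I_k}|x(i)|\right)^p\right)^{1/p}$. For a Banach space $X$, $B(X)$ denotes its closed unit ball, and for a sequence $\{x_n\}$ in $X$, $\mathrm{sep}(\{x_n\})=\inf\{\|x_n-x_m\|: n\ne m\}$. For an integer $k\ge2$, $X$ is called $k$-nearly uniformly convex ($k$-NUC) if for any $\varepsilon>0$ there exists $\delta>0$ such that for every sequence $\{x_n\}\subset B(X)$ with $\mathrm{sep}(\{x_n\})>\varepsilon$ there are $n_1,n_2,\dots,n_k\in\mathbb N$ such that $$\left\|\frac{x_{n_1}+x_{n_2}+\cdots+x_{n_k}}{k}\right\|<1-\delta.$$ *)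

(* Defs.v *)
From HB Require Import structures.
From mathcomp Require Import all_boot all_order all_algebra.
From mathcomp Require Import all_classical all_reals all_analysis.

Set Implicit Arguments.
Unset Strict Implicit.
Unset Printing Implicit Defensive.

Import Order.TTheory GRing.Theory Num.Theory.
Import numFieldNormedType.Exports.

Local Open Scope classical_set_scope.
Local Open Scope ring_scope.

(* All sequences are indexed from 0: [x n] is the mathematical x(n+1) and
   [lam n] is lambda_(n+1). *)

Record lambda_seq (R : realType) (lam : R^nat) : Prop := LambdaSeq {
  lambda_gt0 : forall n, 0 < lam n ;
  lambda_ndecr : nondecreasing_seq lam ;
  lambda_cvgy : lam @ \oo --> +oo ;
  lambda_0 : lam 0%N = 1 ;
  lambda_step : forall n, lam n.+1 <= lam n + 1
}.

Section Vlambda_set.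
Context {R : realType}.
Implicit Types (p : R) (lam x : R^nat).

(* The index k stands for the integer k+1; the integers i+1 that lie in
   I_(k+1) = [(k+1) - lambda_(k+1) + 1, k+1] are selected by the condition.
   No integer below 1 is lost, since lambda_(k+1) <= k+1. *)
Definition vmean lam x (k : nat) : R :=
  (lam k)^-1 * \sum_(i < k.+1 | k.+1%:R - lam k + 1 <= i.+1%:R) `|x i|.

Definition vsum p lam x : \bar R :=
  (\sum_(0 <= k <oo) (vmean lam x k `^ p)%:E)%E.

Definition Vlambda p lam : {pred (nat -> R)} :=
  mem [set x : nat -> R | (vsum p lam x < +oo)%E].

Definition vnorm p lam x : R := fine (vsum p lam x) `^ p^-1.

End Vlambda_set.

Lemma cvg_powR {R : realType} {T : Type} (F : set_system T) (f : T -> R)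
    (a r : R) : Filter F -> 0 < r -> 0 <= a -> (forall t, 0 <= f t) ->
  f @ F --> a -> f t `^ r @[t --> F] --> a `^ r.
Proof.
move=> FF r0; rewrite le_eqVlt => /predU1P[<-|a0] f0 fa.
  rewrite powR0 ?gt_eqF//; apply/cvgrPdist_lt => e e0.
  have er0 : 0 < e `^ r^-1 by exact: powR_gt0.
  move/cvgrPdist_lt : fa => /(_ _ er0); apply: filterS => t.
  rewrite !sub0r !normrN !ger0_norm ?powR_ge0// => /(gt0_ltr_powR r0).
  rewrite !nnegrE f0 powR_ge0 -powRrM mulVf ?gt_eqF// powRr1 ?(ltW e0)//.
  exact.
apply: (@continuous_cvg _ R R F FF f (fun t : R => t `^ r) a) => //.
apply: differentiable_continuous; apply/derivable1_diffP.
by apply: derivable_powR; rewrite in_itv/= a0.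
Qed.

Section Vlambda_theory.
Context {R : realType} (p : R) (lam : R^nat).
Hypotheses (p1 : 1 < p) (hlam : lambda_seq lam).
Implicit Types x y : nat -> R.

Let p0 : 0 < p. Proof. exact: lt_trans p1. Qed.

Lemma vmean_ge0 x k : 0 <= vmean lam x k.
Proof.
by rewrite mulr_ge0 ?invr_ge0 ?(ltW (lambda_gt0 hlam _))// sumr_ge0.
Qed.

Lemma vmeanD x y k : vmean lam (x + y) k <= vmean lam x k + vmean lam y k.
Proof.
rewrite -mulrDr ler_wpM2l ?invr_ge0 ?(ltW (lambda_gt0 hlam _))//.
by rewrite -big_split ler_sum// => i _; exact: ler_normD.
Qed.

Lemma vmeanZ a x k : vmean lam (a *: x) k = `|a| * vmean lam x k.
Proof.
rewrite /vmean mulrCA; congr (_ * _); rewrite big_distrr /=.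
by apply: eq_bigr => i _; rewrite -normrM.
Qed.

Lemma lambda_ge1 k : 1 <= lam k.
Proof. by rewrite -(lambda_0 hlam); exact: (lambda_ndecr hlam). Qed.

Lemma le_vmean x k : `|x k| <= lam k * vmean lam x k.
Proof.
rewrite mulrA divff ?gt_eqF ?(lambda_gt0 hlam)// mul1r.
rewrite (bigD1 ord_max)/=; last first.
  by rewrite -addrA gerDl addrC subr_le0 lambda_ge1.
by rewrite lerDl sumr_ge0.
Qed.

Lemma vsum_ge0 x : (0 <= vsum p lam x)%E.
Proof. by apply: nneseries_ge0 => k _ _; rewrite lee_fin powR_ge0. Qed.

Lemma vnorm_ge0 x : 0 <= vnorm p lam x.
Proof. exact: powR_ge0. Qed.

Lemma VlambdaP x : (x \in Vlambda p lam) <-> (vsum p lam x < +oo)%E.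
Proof. by rewrite inE. Qed.

Lemma vsumE x : x \in Vlambda p lam -> vsum p lam x = (vnorm p lam x `^ p)%:E.
Proof.
move=> /VlambdaP xV; rewrite /vnorm -powRrM mulVf ?gt_eqF// powRr1.
  by rewrite fineK// ge0_fin_numE// vsum_ge0.
by rewrite fine_ge0// vsum_ge0.
Qed.

Lemma vsum_le x (B : R) : 0 <= B ->
  (forall n, \sum_(k < n) vmean lam x k `^ p <= B `^ p) ->
  x \in Vlambda p lam /\ vnorm p lam x <= B.
Proof.
move=> B0 H.
have xB : (vsum p lam x <= (B `^ p)%:E)%E.
  apply: lime_le; first by apply: is_cvg_nneseries => k _ _; rewrite lee_fin powR_ge0.
  by apply: nearW => n; rewrite sumEFin lee_fin big_mkord.
have xV : x \in Vlambda p lam.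
  by apply/VlambdaP; rewrite (le_lt_trans xB)// ltry.
split=> //; move: xB; rewrite vsumE// lee_fin => h.
rewrite leNgt; apply/negP => /(gt0_ltr_powR p0) lt; move: h.
by rewrite leNgt lt// nnegrE ?vnorm_ge0.
Qed.

Lemma le_vnorm_sum x n : x \in Vlambda p lam ->
  \sum_(k < n) vmean lam x k `^ p <= vnorm p lam x `^ p.
Proof.
move=> xV; rewrite -lee_fin -vsumE// -sumEFin -(big_mkord xpredT (fun k => (vmean lam x k `^ p)%:E)).
by apply: nneseries_lim_ge => k _ _; rewrite lee_fin powR_ge0.
Qed.

Lemma le_vnorm x k : x \in Vlambda p lam -> `|x k| <= lam k * vnorm p lam x.
Proof.
move=> xV; apply: le_trans (le_vmean x k) _.
rewrite ler_wpM2l ?(ltW (lambda_gt0 hlam _))//.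
have : vmean lam x k `^ p <= vnorm p lam x `^ p.
  apply: le_trans (le_vnorm_sum k.+1 xV).
  by rewrite big_ord_recr/= lerDr sumr_ge0// => i _; rewrite powR_ge0.
rewrite leNgt => h; rewrite leNgt; apply: contra h => h.
by rewrite gt0_ltr_powR// nnegrE ?vmean_ge0 ?vnorm_ge0.
Qed.

Lemma vsum_Lnorm x :
  (vsum p lam x `^ p^-1 = 'N[counting]_p%:E [EFin \o vmean lam x])%E.
Proof.
rewrite Lnorm_counting//; congr (_ `^ _)%E.
apply: eq_eseriesr => k _ /=.
by rewrite ger0_norm ?vmean_ge0.
Qed.

Lemma vsumD x y :
  (vsum p lam (x + y)%R `^ p^-1 <= vsum p lam x `^ p^-1 + vsum p lam y `^ p^-1)%E.
Proof.
rewrite (vsum_Lnorm x) (vsum_Lnorm y).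
apply: (@le_trans _ _
    'N[counting]_p%:E [EFin \o (vmean lam x \+ vmean lam y)%R]%E).
  rewrite Lnorm_counting//; apply: gt0_ler_poweR.
  - by rewrite invr_ge0 ltW.
  - by rewrite in_itv/= vsum_ge0 leey.
  - rewrite in_itv/= leey andbT; apply: nneseries_ge0 => k _ _.
    by rewrite lee_fin powR_ge0.
  apply: lee_nneseries => k _ /=; first by rewrite lee_fin powR_ge0.
  rewrite lee_fin ge0_ler_powR ?nnegrE ?vmean_ge0 ?normr_ge0 ?(ltW p0)//.
  by rewrite ger0_norm ?addr_ge0 ?vmean_ge0// vmeanD.
apply: (@minkowski_EFin _ _ _ counting (vmean lam x) (vmean lam y)) => //.
exact: ltW.
Qed.

Lemma vsum_vnorm x : x \in Vlambda p lam ->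
  (vsum p lam x `^ p^-1 = (vnorm p lam x)%:E)%E.
Proof.
move=> xV; rewrite vsumE// poweR_EFin -powRrM mulfV ?gt_eqF// powRr1//.
exact: vnorm_ge0.
Qed.

Lemma Vlambda_vnormD x y : x \in Vlambda p lam -> y \in Vlambda p lam ->
  x + y \in Vlambda p lam /\
  vnorm p lam (x + y) <= vnorm p lam x + vnorm p lam y.
Proof.
move=> xV yV; have := vsumD x y; rewrite (vsum_vnorm xV) (vsum_vnorm yV) -EFinD => h.
have xyV : x + y \in Vlambda p lam.
  apply/VlambdaP; rewrite ltey; apply/eqP => e; move: h.
  by rewrite e poweRyr ?invr_eq0 ?gt_eqF// leye_eq.
by split=> //; move: h; rewrite vsum_vnorm.
Qed.

Lemma vsumZ a x : vsum p lam (a *: x)%R = ((`|a| `^ p)%:E * vsum p lam x)%E.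
Proof.
rewrite /vsum -nneseriesZl; last by move=> k _; rewrite lee_fin powR_ge0.
by apply: eq_eseriesr => k _; rewrite vmeanZ powRM ?vmean_ge0.
Qed.

Lemma VlambdaZ a x : x \in Vlambda p lam -> a *: x \in Vlambda p lam.
Proof.
by move=> xV; apply/VlambdaP; rewrite vsumZ vsumE// -EFinM ltry.
Qed.

Lemma vnormZ a x : x \in Vlambda p lam ->
  vnorm p lam (a *: x) = `|a| * vnorm p lam x.
Proof.
move=> xV; apply: EFin_inj; rewrite -vsum_vnorm ?VlambdaZ//.
rewrite vsumZ vsumE// -EFinM poweR_EFin -powRM ?vnorm_ge0//.
by rewrite -powRrM mulfV ?gt_eqF// powRr1// mulr_ge0 ?vnorm_ge0.
Qed.

Lemma Vlambda0 : 0 \in Vlambda p lam.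
Proof.
apply/VlambdaP; rewrite -[0 : nat -> R](scale0r 0) vsumZ normr0.
by rewrite powR0 ?gt_eqF// mul0e ltry.
Qed.

Lemma Vlambda_submod_closed : submod_closed (Vlambda p lam).
Proof.
split; first exact: Vlambda0.
move=> a x y xV yV; exact: (Vlambda_vnormD (VlambdaZ a xV) yV).1.
Qed.

Lemma vnorm_eq0 x : x \in Vlambda p lam -> vnorm p lam x = 0 -> x = 0.
Proof.
move=> xV x0; apply/funext => k; apply/normr0_eq0/eqP.
by rewrite eq_le normr_ge0 andbT; have := le_vnorm k xV; rewrite x0 mulr0.
Qed.

End Vlambda_theory.

Section Vlambda_type.
Context {R : realType} (p : R) (lam : R^nat).
Variables (p1 : 1 < p) (hlam : lambda_seq lam).

(* The otherwise unused proofs [p1] and [hlam] are parameters here so that the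
   Banach space structure below can be inferred from the type. *)
Definition Vlambda_carrier (p1 : 1 < p) (hlam : lambda_seq lam) :=
  Vlambda p lam.

Record VlambdaType := MkVlambda {
  Vlambda_seq :> nat -> R ;
  Vlambda_seqP : Vlambda_seq \in Vlambda_carrier p1 hlam }.

Local Notation V := VlambdaType.

HB.instance Definition _ := [isSub for Vlambda_seq].
HB.instance Definition _ := [Choice of V by <:].

HB.instance Definition _ := GRing.isSubmodClosed.Build R (nat -> R)
  (Vlambda_carrier p1 hlam) (Vlambda_submod_closed p1 hlam).
HB.instance Definition _ := [SubChoice_isSubLmodule of V by <:].

Let vnormT (x : V) : R := vnorm p lam x.

Let vnormT_D (x y : V) : vnormT (x + y) <= vnormT x + vnormT y.
Proof.
exact: (Vlambda_vnormD p1 hlam (Vlambda_seqP x) (Vlambda_seqP y)).2.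
Qed.

Let vnormT_Z (a : R) (x : V) : vnormT (a *: x) = `|a| * vnormT x.
Proof. exact: (vnormZ p1 hlam a (Vlambda_seqP x)). Qed.

Let vnormT_eq0 (x : V) : vnormT x = 0 -> x = 0.
Proof.
by move=> x0; apply/val_inj; exact: (vnorm_eq0 p1 hlam (Vlambda_seqP x) x0).
Qed.

HB.instance Definition _ :=
  Lmodule_isNormed.Build R V vnormT_D vnormT_Z vnormT_eq0.

Let cvg_coord (F : set_system V) (FF : ProperFilter F) (k : nat) :
  cauchy F -> cvg ((x : V) k @[x --> F]).
Proof.
move=> /cauchy_ballP Fc; apply/cauchy_cvgP/cauchy_ballP => e e0.
have lk0 : 0 < lam k := lambda_gt0 hlam k.
rewrite near_map2; apply: filterS (Fc (e / lam k) (divr_gt0 e0 lk0)) => -[x y].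
rewrite -!ball_normE/= ltr_pdivlMr// mulrC; apply: le_lt_trans.
exact: (le_vnorm p1 hlam k (Vlambda_seqP (x - y))).
Qed.

Let cvg_vmean (F : set_system V) (FF : ProperFilter F) (x l : nat -> R) k :
  (forall i, (y : V) i @[y --> F] --> l i) ->
  vmean lam (x - Vlambda_seq y) k `^ p @[y --> F] --> vmean lam (x - l) k `^ p.
Proof.
move=> Fl; apply: cvg_powR; [exact: lt_trans p1|exact: vmean_ge0|by move=> y; exact: vmean_ge0|].
apply: cvgMl_tmp; apply: cvg_big; first exact: add_continuous.
move=> i _; apply: cvg_norm.
by apply: cvgB; [exact: cvg_cst|exact: Fl].
Qed.

Let V_complete (F : set_system V) : ProperFilter F -> cauchy F -> cvg F.
Proof.
move=> FF Fc; pose l : nat -> R := fun k => lim ((x : V) k @[x --> F]).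
have Fl k : (x : V) k @[x --> F] --> l k by exact: cvg_coord.
have Fxl e : 0 < e -> \forall x \near F,
    Vlambda_seq x - l \in Vlambda p lam /\ vnorm p lam (Vlambda_seq x - l) <= e.
  move=> e0.
  have Fe : \forall x \near F & y \near F, `|x - y| < e.
    have /cauchy_ballP/(_ e e0) := Fc; apply: filterS => -[x y].
    by rewrite -ball_normE.
  near=> x.
  have xF : \forall y \near F, `|x - y| < e.
    by near: x; apply: nearP_dep; exact: Fe.
  apply: (vsum_le p1 (ltW e0)) => n.
  have H : \sum_(k < n) vmean lam (Vlambda_seq x - Vlambda_seq y) k `^ p @[y --> F] -->
      \sum_(k < n) vmean lam (Vlambda_seq x - l) k `^ p.
    by apply: cvg_big => [|k _]; [exact: add_continuous|exact: cvg_vmean].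
  rewrite -(cvg_lim _ H)//; apply: limr_le; first by apply/cvg_ex; eexists; exact: H.
  apply: filterS xF => y xy.
  apply: le_trans (le_vnorm_sum p1 n (Vlambda_seqP (x - y))) _.
  rewrite ge0_ler_powR ?nnegrE ?vnorm_ge0 ?(ltW e0)//; last exact: ltW.
  by rewrite (le_trans _ (ltW p1)).
have lV : l \in Vlambda_carrier p1 hlam.
  have [x [xlV _]] := filter_ex (Fxl 1 ltr01).
  by rewrite -(subKr (x : nat -> R) l) rpredB//; exact: Vlambda_seqP.
apply/cvg_ex; exists (MkVlambda lV); apply/cvgrPdist_le => e e0.
by apply: filterS (Fxl e e0) => x [_]; rewrite distrC.
Unshelve. all: by end_near. Qed.

HB.instance Definition _ := Uniform_isComplete.Build V V_complete.

Lemma normVE (x : V) : `|x| = vnorm p lam x.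
Proof. by []. Qed.

End Vlambda_type.

Section kNUC.
Context {R : realType}.

Definition sep (X : normedModType R) (x : nat -> X) : R :=
  inf [set `|x nm.1 - x nm.2| | nm in [set nm : nat * nat | nm.1 != nm.2]].

Definition kNUC (X : completeNormedModType R) (k : nat) : Prop :=
  forall eps : R, 0 < eps -> exists2 delta : R, 0 < delta &
    forall x : nat -> X, (forall n, `|x n| <= 1) -> eps < sep x ->
      exists n : 'I_k -> nat,
        `| k%:R^-1 *: \sum_(j < k) x (n j) | < 1 - delta.

End kNUC.

(* Main.v *)
Require Import Defs.
From mathcomp Require Import all_boot all_order all_algebra.
From mathcomp Require Import all_classical all_reals all_analysis.
From mathcomp Require Import ring lra.

Set Implicit Arguments.
Unset Strict Implicit.
Unset Printing Implicit Defensive.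

Import Order.TTheory GRing.Theory Num.Theory.
Import numFieldNormedType.Exports.

Local Open Scope classical_set_scope.
Local Open Scope ring_scope.

(** Why the theorem holds. The p-th power of the norm of [x] is the series of
    the p-th powers of the means of [`|x|], and the k-th mean sees only the
    coordinates up to [k]. So each head of the series lives in finite
    dimension, and what a separated sequence keeps apart must reach its tails.

    It is enough to treat two vectors ([kNUC_from2]): if [(x_a + x_b) / 2] is
    well inside the unit ball, completing the pair [x_a], [x_b] by arbitrary
    vectors of the ball still gives an average well inside the ball.

    For two vectors, fix [x_0] and an [N] beyond which its series is negligible
    ([vsum_tail_small]). By pigeonhole two members of the sequence nearly agree
    on the coordinates below [N]; as they are [eps] apart in norm, one of them,
    say [x_m], has a tail sum of at least [eps^p / (2 * 2^p)]
    ([sep_vsum_tail]). Beyond [N] the midpoint is almost [x_m / 2], whose sum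
    is only about [2^-p] times that of [x_m]: on the head the midpoint costs at
    most half of each sum, but on the tail, up to a multiple of the negligible
    tail sum of [x_0], it costs only [c] times the sum of [x_m], with [c < 1/2]
    since [1 < p] ([vsum_midpoint]). The gain [(1/2 - c) * eps^p / (2 * 2^p)]
    depends on [eps] and [p] alone, which is the uniformity that the definition
    asks for.

    All estimates are made on finite partial sums, and [vsum_le] turns a uniform
    bound on these into a bound on the norm. *)

(** * Reduction to two vectors *)

(** The pair supplied by the case of two vectors is completed by copies of
    [x_0]; by the triangle inequality at least the fraction [1 / k] of the gain
    survives. *)
Lemma kNUC_from2 (R : realType) (X : completeNormedModType R) (k : nat) :
  (2 <= k)%N -> kNUC X 2 -> kNUC X k.
Proof.
case: k => [|[|k]]// _ X2 eps /X2[delta delta0 H].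
exists (delta / k.+2%:R); first by rewrite divr_gt0.
move=> x x1 xsep; have [n] := H x x1 xsep.
rewrite !big_ord_recl big_ord0 addr0 normrZ ger0_norm// => hn.
exists (fun j : 'I_k.+2 => if (j < 2)%N then n (inord j) else 0%N).
rewrite !big_ord_recl/= addrA normrZ ger0_norm ?invr_ge0//.
set y := x _ + x _ in hn; set z := \sum_(_ < _) _.
have -> : x (n (inord 0)) + x (n (inord (bump 0 0))) = y.
  by congr (x (n _) + x (n _)); apply/val_inj; rewrite /= inordK.
have zk : `|z| <= k%:R.
  apply: le_trans (ler_norm_sum _ _ _) _.
  apply: (@le_trans _ _ (\sum_(i < k) 1)); first exact: ler_sum.
  by rewrite sumr_const card_ord.
have k2 : 0 < k.+2%:R :> R by [].
rewrite -(ltr_pM2l k2) mulrA mulfV ?gt_eqF// mul1r.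
rewrite mulrBr mulrCA mulfV ?gt_eqF// !mulr1.
have := ler_normD y z; rewrite -[k.+2]addn2 natrD.
by lra.
Qed.

(** * Convexity of the p-th power *)

Lemma powR_conv (R : realType) (p t a b : R) :
  1 <= p -> 0 <= t <= 1 -> 0 <= a -> 0 <= b ->
  (t * a + (1 - t) * b) `^ p <= t * a `^ p + (1 - t) * b `^ p.
Proof.
move=> p1 /andP[t0 t1] a0 b0.
have h0 (c : R) : 0 <= c -> c \in (`[0, +oo[%classic : set R).
  by move=> c0; rewrite inE/= in_itv/= c0.
exact: (convex_powR p1 (@Itv01 R t t0 t1) (h0 a a0) (h0 b b0)).
Qed.

Lemma powR_midpoint (R : realType) (p a b : R) : 1 <= p -> 0 <= a -> 0 <= b ->
  ((a + b) / 2) `^ p <= (a `^ p + b `^ p) / 2.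
Proof.
move=> p1 a0 b0; have := @powR_conv R p 2^-1 a b p1 _ a0 b0.
rewrite (_ : 2^-1 * a + (1 - 2^-1) * b = (a + b) / 2); last by field.
rewrite (_ : 2^-1 * a `^ p + _ = (a `^ p + b `^ p) / 2); last by field.
by apply => //; apply/andP; split; lra.
Qed.

(** Convexity with weights 1/4 and 3/4, from
    [(a + b) / 2 = 1/4 * (2 a) + 3/4 * (2/3 b)]. The coefficient of [b^p] is
    strictly below 1/2 ([skew_coef_lt]), at the price of a large coefficient
    for [a^p]; this is what helps where [a] is negligible. Any weight of [b]
    strictly between 1/2 and 1 would do. *)
Lemma powR_skew_midpoint (R : realType) (p a b : R) :
  1 <= p -> 0 <= a -> 0 <= b ->
  ((a + b) / 2) `^ p
    <= 4^-1 * 2 `^ p * a `^ p + 3 / 4 * (2 / 3) `^ p * b `^ p.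
Proof.
move=> p1 a0 b0; rewrite -!mulrA -powRM// -powRM//.
have t01 : 0 <= (4^-1 : R) <= 1 by apply/andP; split; lra.
have := @powR_conv R p 4^-1 (2 * a) (2 / 3 * b) p1 t01.
rewrite (_ : 4^-1 * (2 * a) + (1 - 4^-1) * (2 / 3 * b) = (a + b) / 2);
  last by field.
rewrite (_ : 1 - 4^-1 = 3 / 4); last by field.
by rewrite -!mulrA; apply; lra.
Qed.

(** At [p = 1] both sides are equal, and [(2/3)^p] decreases strictly in [p]. *)
Lemma skew_coef_lt (R : realType) (p : R) :
  1 < p -> 3 / 4 * (2 / 3) `^ p < 2^-1 :> R.
Proof.
move=> p1; have c0 : 0 < 2 / 3 :> R by lra.
have : (2 / 3) `^ p < 2 / 3 :> R; last lra.
rewrite /powR gt_eqF// -[ltRHS]lnK// ltr_expR.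
have : ln (2 / 3) < 0 :> R by apply: ln_lt0; lra.
by move: (ln _) => u u0; nra.
Qed.

(** * Pigeonhole in finitely many coordinates *)

Lemma finType_collision (T : finType) (f : nat -> T) :
  exists m m' : nat, m != m' /\ f m = f m'.
Proof.
pose g (i : 'I_#|T|.+1) := f i.
have /injectivePn[i [j ij gij]] : ~~ injectiveb g.
  by apply/injectiveP => /leq_card; rewrite card_ord ltnn.
by exists i, j.
Qed.

(** Total boundedness of a cube: cut [[-B, B]^N] into finitely many cells of
    side [e]; two of the vectors fall into the same cell. *)
Lemma bounded_close_pair (R : realType) (N : nat) (x : nat -> nat -> R)
    (B e : R) :
  0 < e -> (forall m i, (i < N)%N -> `|x m i| <= B) ->
  exists m m' : nat, m != m' /\
    forall i, (i < N)%N -> `|x m i - x m' i| <= e.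
Proof.
move=> e0 xB; pose c m i := (x m i + B) / e.
pose f m := [ffun i : 'I_N =>
  inord (Num.trunc (c m i)) : 'I_(Num.trunc (2 * B / e)).+1].
have [m [m' [mm' fmm']]] := finType_collision f.
exists m, m'; split=> // i iN.
have c0 n : 0 <= c n i.
  by rewrite divr_ge0 ?(ltW e0)//; have := xB n i iN; rewrite ler_norml; lra.
have cK n : nat_of_ord (f n (Ordinal iN)) = Num.trunc (c n i).
  rewrite ffunE/= inordK// ltnS le_truncn// ler_pM2r ?invr_gt0//.
  by have := xB n i iN; rewrite ler_norml; lra.
have := truncn_itv (c0 m); have := truncn_itv (c0 m').
rewrite -!cK fmm'; move: (nat_of_ord _) => t; rewrite -!natr1 => tm' tm.
have -> : x m i - x m' i = e * (c m i - c m' i).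
  by rewrite /c; field; rewrite gt_eqF.
by rewrite normrM gtr0_norm// ler_piMr ?(ltW e0)// ler_norml; lra.
Qed.

(** * Heads and tails of the norm series *)

Section Vlambda.
Context {R : realType} (p : R) (lam : R^nat).
Hypotheses (p1 : 1 < p) (hlam : lambda_seq lam).
Implicit Types x y : nat -> R.

Let p0 : 0 < p. Proof. exact: lt_trans p1. Qed.

Let le_powR (a b : R) : 0 <= a -> a <= b -> a `^ p <= b `^ p.
Proof.
by move=> a0 ab; rewrite ge0_ler_powR ?nnegrE ?(ltW p0)// (le_trans a0).
Qed.

Lemma vmean_half x y k :
  vmean lam (2^-1 *: (x + y)) k <= (vmean lam x k + vmean lam y k) / 2.
Proof.
by rewrite vmeanZ ger0_norm ?invr_ge0// mulrC ler_pM2r ?invr_gt0// vmeanD.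
Qed.

Lemma vmeanB_powR x y k :
  vmean lam (x - y) k `^ p
    <= 2 `^ p / 2 * (vmean lam x k `^ p + vmean lam y k `^ p).
Proof.
have vN : vmean lam (- y) k = vmean lam y k.
  by rewrite -scaleN1r vmeanZ normrN1 mul1r.
have := vmeanD hlam x (- y) k; rewrite vN => /le_powR h.
apply: (le_trans (h (vmean_ge0 hlam _ _))).
have -> : forall u v : R, u + v = 2 * ((u + v) / 2) by move=> u v; field.
rewrite powRM//; last by rewrite divr_ge0 ?addr_ge0 ?vmean_ge0.
rewrite -mulrA (mulrC 2^-1) ler_wpM2l ?powR_ge0//.
by rewrite powR_midpoint ?vmean_ge0// ltW.
Qed.

(** The head of the series is continuous in finitely many coordinates. The
    crude bound [vmean lam x k <= N * e] suffices: the weights [(lam k)^-1] are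
    at most 1 and the mean has at most [k + 1 <= N] terms. *)
Lemma vsum_head_small (N : nat) (tau : R) : 0 < tau ->
  exists2 e : R, 0 < e & forall x,
    (forall i, (i < N)%N -> `|x i| <= e) ->
    \sum_(0 <= k < N) vmean lam x k `^ p <= tau.
Proof.
move=> tau0; pose s := (tau / N.+1%:R) `^ p^-1.
have s0 : 0 < s by rewrite powR_gt0// divr_gt0.
exists (s / N.+1%:R); first by rewrite divr_gt0.
move=> x xe.
have xk k : (k < N)%N -> vmean lam x k `^ p <= tau / N.+1%:R.
  move=> kN; have -> : tau / N.+1%:R = s `^ p.
    by rewrite /s -powRrM mulVf ?gt_eqF// powRr1// divr_ge0// ltW.
  apply: le_powR; first exact: vmean_ge0.
  apply: (@le_trans _ _ (\sum_(i < k.+1) s / N.+1%:R)).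
    rewrite /vmean; apply: (@le_trans _ _ (\sum_(i < k.+1) `|x i|)).
      apply: (@le_trans _ _
        (\sum_(i < k.+1 | k.+1%:R - lam k + 1 <= i.+1%:R) `|x i|)).
        rewrite ler_piMl ?sumr_ge0// invf_le1 ?(lambda_gt0 hlam)//.
        exact: lambda_ge1.
      rewrite [leRHS](bigID (fun i : 'I__ => k.+1%:R - lam k + 1 <= i.+1%:R))/=.
      by rewrite lerDl sumr_ge0.
    by apply: ler_sum => i _; apply: xe; exact: leq_trans (ltn_ord i) kN.
  rewrite sumr_const card_ord -[leLHS]mulr_natr -mulrA ler_piMr ?(ltW s0)//.
  by rewrite ler_pdivrMl// mulr1 ler_nat ltnS ltnW.
apply: (@le_trans _ _ (\sum_(0 <= k < N) tau / N.+1%:R)).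
  by rewrite !big_nat; apply: ler_sum => k /andP[_]; exact: xk.
rewrite big_mkord sumr_const card_ord -[leLHS]mulr_natr -mulrA.
rewrite ler_piMr ?(ltW tau0)//.
by rewrite ler_pdivrMl// mulr1 ler_nat.
Qed.

Lemma vsum_tail_small x (tau : R) : x \in Vlambda p lam -> 0 < tau ->
  exists N, forall M, (N <= M)%N ->
    \sum_(N <= k < M) vmean lam x k `^ p <= tau.
Proof.
move=> xV tau0; pose S n := \sum_(0 <= k < n) vmean lam x k `^ p.
have Sub n : S n <= vnorm p lam x `^ p.
  by rewrite /S big_mkord; exact: le_vnorm_sum.
have supS : has_sup (range S).
  split; first by exists (S 0%N), 0%N.
  by exists (vnorm p lam x `^ p) => _ [n _ <-].
have [_ [N _ <-] SN] := sup_adherent tau0 supS.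
exists N => M NM.
have : S M <= sup (range S) by apply: sup_upper_bound => //; exists M.
by rewrite {1}/S (big_cat_nat _ NM)//= -/(S N); lra.
Qed.

(** The bound does not depend on [N]. Two vectors that nearly agree below [N]
    have a difference whose head sum is at most [eps^p / 2], hence whose tail
    sum exceeds [eps^p / 2]; by [vmeanB_powR] the latter is at most
    [2^p / 2] times the two tail sums together, so one of them is large. *)
Lemma sep_vsum_tail (eps : R) (x : nat -> VlambdaType p1 hlam) (N : nat) :
  0 < eps -> (forall n, `|x n| <= 1) -> eps < sep x ->
  exists m M, (N <= M)%N /\
    eps `^ p / (2 * 2 `^ p) <= \sum_(N <= k < M) vmean lam (x m) k `^ p.
Proof.
move=> eps0 x1 xsep.
have ep0 : 0 < eps `^ p by rewrite powR_gt0.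
have [e e0 He] := vsum_head_small N (divr_gt0 ep0 (ltr0n R 2)).
have xB m i : (i < N)%N -> `|(x m : nat -> R) i| <= lam N.
  move=> iN; apply: (le_trans (le_vnorm p1 hlam i (Vlambda_seqP (x m)))).
  rewrite -normVE (le_trans (ler_piMr _ (x1 m))) ?(ltW (lambda_gt0 hlam _))//.
  by apply: (lambda_ndecr hlam); exact: ltnW.
have [m [m' [mm' close]]] := bounded_close_pair e0 xB.
have epsd : eps < vnorm p lam (x m - x m').
  apply: (lt_le_trans xsep); rewrite -[leRHS](normVE (x m - x m')).
  apply: ge_inf; first by exists 0 => _ [nm _ <-].
  by exists (m, m').
pose d : nat -> R := Vlambda_seq (x m) - Vlambda_seq (x m').
have [M HM] : exists M, eps `^ p < \sum_(k < M) vmean lam d k `^ p.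
  apply: contrapT => /forallNP H; move: epsd; apply/negP; rewrite -leNgt.
  apply: (vsum_le p1 (ltW eps0) _).2 => n.
  by rewrite leNgt; apply/negP; exact: H.
(* The witness [M] may lie below [N]; partial sums only grow. *)
have {}HM : eps `^ p < \sum_(0 <= k < maxn N M) vmean lam d k `^ p.
  apply: (lt_le_trans HM).
  rewrite -(big_mkord xpredT (fun k => vmean lam d k `^ p)).
  rewrite (big_cat_nat _ (leq_maxr N M))//= lerDl sumr_ge0// => k _.
  exact: powR_ge0.
have NM : (N <= maxn N M)%N := leq_maxl N M.
have := He d close; move: HM; rewrite (big_cat_nat _ NM)//=.
move: (maxn N M) NM => {}M NM HM dN.
have : \sum_(N <= k < M) vmean lam d k `^ p <= 2 `^ p / 2 *
    (\sum_(N <= k < M) vmean lam (x m) k `^ p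
     + \sum_(N <= k < M) vmean lam (x m') k `^ p).
  by rewrite -big_split/= mulr_sumr ler_sum// => k _; exact: vmeanB_powR.
set A := \sum_(_ <= _ < _) vmean lam (x m) _ `^ p.
set A' := \sum_(_ <= _ < _) vmean lam (x m') _ `^ p => dA.
have tp0 : 0 < 2 `^ p :> R by rewrite powR_gt0.
have AA' : eps `^ p / 2 < 2 `^ p / 2 * (A + A') by lra.
case: (leP A A') => AA; [exists m', M|exists m, M]; split=> //.
  by rewrite -/A' ler_pdivrMr ?mulr_gt0//; nra.
by rewrite -/A ler_pdivrMr ?mulr_gt0//; nra.
Qed.

(** Weights 1/2 and 1/2 below [N], weights 1/4 and 3/4 beyond: [x] is meant to
    have a negligible tail, so that its large coefficient there is harmless. *)
Lemma vsum_midpoint x y N M : (N <= M)%N ->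
  \sum_(0 <= k < M) vmean lam (2^-1 *: (x + y)) k `^ p
    <= (\sum_(0 <= k < N) vmean lam x k `^ p
        + \sum_(0 <= k < N) vmean lam y k `^ p) / 2
     + 4^-1 * 2 `^ p * \sum_(N <= k < M) vmean lam x k `^ p
     + 3 / 4 * (2 / 3) `^ p * \sum_(N <= k < M) vmean lam y k `^ p.
Proof.
move=> NM; rewrite (big_cat_nat _ NM)//= -addrA; apply: lerD.
  rewrite -big_split/= mulr_suml ler_sum// => k _.
  apply: (le_trans (le_powR (vmean_ge0 hlam _ _) (vmean_half x y k))).
  by rewrite powR_midpoint ?vmean_ge0// ltW.
rewrite !mulr_sumr -big_split/= ler_sum// => k _.
apply: (le_trans (le_powR (vmean_ge0 hlam _ _) (vmean_half x y k))).
by rewrite powR_skew_midpoint ?vmean_ge0// ltW.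
Qed.

(** * Nearly uniform convexity *)

Lemma Vlambda_2NUC : kNUC (VlambdaType p1 hlam) 2.
Proof.
move=> eps eps0.
pose tau : R := eps `^ p / (2 * 2 `^ p).
pose c : R := 3 / 4 * (2 / 3) `^ p.
pose C : R := 4^-1 * 2 `^ p.
have tau0 : 0 < tau by rewrite divr_gt0 ?mulr_gt0 ?powR_gt0.
have c2 : c < 2^-1 := skew_coef_lt p1.
have C0 : 0 < C by rewrite mulr_gt0 ?powR_gt0.
(* Half of the gain [(1/2 - c) * tau] absorbs the tail of [x 0]; the minimum
   with 1 keeps [1 - g] nonnegative when [eps] is large. *)
pose g := Num.min 1 ((2^-1 - c) * tau / 2).
have g0 : 0 < g by rewrite lt_min ltr01/= divr_gt0// mulr_gt0// subr_gt0.
have g1 : g <= 1 by rewrite ge_min lexx.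
have gle : g <= (2^-1 - c) * tau / 2 by rewrite ge_min lexx orbT.
pose B := (1 - g) `^ p^-1.
have BE : B `^ p = 1 - g.
  by rewrite /B -powRrM mulVf ?gt_eqF// powRr1// subr_ge0.
have B0 : 0 <= B by exact: powR_ge0.
have B1 : B < 1.
  rewrite ltNge; apply/negP => /(le_powR ler01).
  by rewrite BE powR1; lra.
exists ((1 - B) / 2); first by rewrite divr_gt0// subr_gt0.
move=> x x1 xsep.
have eta0 : 0 < (2^-1 - c) * tau / 2 / C.
  by rewrite !divr_gt0// mulr_gt0// subr_gt0.
have [N x0N] := vsum_tail_small (Vlambda_seqP (x 0%N)) eta0.
have [m [M [NM xmN]]] := sep_vsum_tail N eps0 x1 xsep.
exists (fun j => if j == ord0 then 0%N else m).
rewrite !big_ord_recl big_ord0/= addr0.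
apply: (@le_lt_trans _ _ B); last lra.
have le1 n K : \sum_(0 <= k < K) vmean lam (x n) k `^ p <= 1.
  rewrite big_mkord; apply: le_trans (le_vnorm_sum p1 K (Vlambda_seqP (x n))) _.
  have one_p : 1 = 1 `^ p :> R by rewrite powR1.
  by rewrite [leRHS]one_p le_powR// ?vnorm_ge0//; exact: x1.
rewrite normVE; apply: (vsum_le p1 B0 _).2 => n.
rewrite -(big_mkord xpredT (fun k => vmean lam _ k `^ p)) BE.
apply: (@le_trans _ _ (\sum_(0 <= k < maxn M n)
    vmean lam (2^-1 *: (Vlambda_seq (x 0%N) + Vlambda_seq (x m))) k `^ p)).
  rewrite [leRHS](big_cat_nat _ (leq_maxr M n))//= lerDl sumr_ge0// => k _.
  exact: powR_ge0.
have NK : (N <= maxn M n)%N := leq_trans NM (leq_maxl M n).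
apply: (le_trans (vsum_midpoint _ _ NK)).
rewrite -/c -/C.
have {}xmN : tau <= \sum_(N <= k < maxn M n) vmean lam (x m) k `^ p.
  apply: (le_trans xmN); rewrite [leRHS](big_cat_nat _ (leq_maxl M n))//=.
  by rewrite lerDl sumr_ge0// => k _; exact: powR_ge0.
have {}x0N := x0N _ NK.
have := le1 0%N N; have := le1 m (maxn M n).
rewrite (big_cat_nat _ NK)//=.
move: x0N xmN; rewrite ler_pdivlMr// mulrC.
move: (\sum_(0 <= k < N) _) (\sum_(0 <= k < N) _) => b a.
move: (\sum_(N <= k < _) _) (\sum_(N <= k < _) _) => b' a'.
nra.
Qed.

End Vlambda.

Theorem theorem3p2 (R : realType) (p : R) (lam : R^nat)
    (p1 : 1 < p) (hlam : lambda_seq lam) (k : nat) (hk : (2 <= k)%N) :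
  kNUC (VlambdaType p1 hlam) k.
Proof. exact: kNUC_from2 hk (Vlambda_2NUC p1 hlam). Qed.
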